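(* If $(\mathbb Z^2,a)$ is a uniformly elliptic weighted graph, then for all finite subsets $A\subset\mathbb Z^2$ and for all $y\in A$, the limit $\lim_{D(x,A)\to\infty}\overline H_A(x,y)$ exists.
   Context: $(\mathbb Z^2,a)$ is the lattice $\mathbb Z^2$ with nearest-neighbour edges ($x\sim y$ iff $|x-y|_1=1$) and symmetric weights $a(x,y)=a(y,x)$, with $a(x,y)=0$ if $x,y$ are not nearest neighbours. It is uniformly elliptic if there is a constant $c\ge1$ such that $c^{-1}\le a(e)\le c$ for all edges $e$. Put $\pi(x)=\sum_ya(x,y)$. The random walk $(X_k)_{k\ge0}$ is the Markov chain with transition probabilities $p(x,y)=a(x,y)/\pi(x)$, with law $P_x$ when started at $x$. $D$ is the graph distance and $D(x,A)=\inf_{y\in A}D(x,y)$. $\tau_A=\inf\{k\ge1:X_k\in A\}$ and, when $P_x(\tau_A<\infty)>0$, $\overline H_A(x,y)=P_x(X_{\tau_A}=y\mid\tau_A<\infty)$ for $y\in A$. *)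

(* Defs.v *)
From mathcomp Require Import all_boot all_order all_algebra.
From mathcomp Require Import all_classical all_reals all_analysis.

Set Implicit Arguments.
Unset Strict Implicit.
Unset Printing Implicit Defensive.

Import Order.TTheory GRing.Theory Num.Theory.
Import numFieldNormedType.Exports.
Local Open Scope classical_set_scope.
Local Open Scope ring_scope.

Definition Z2 : Type := (int * int)%type.

Definition nbr : rel Z2 := fun x y => `|x.1 - y.1| + `|x.2 - y.2| == 1.

Section WeightedLattice.
Context {R : realType}.
Implicit Types (a : Z2 -> Z2 -> R) (x y : Z2) (A : set Z2).

Definition weighted_lattice a :=
  (forall x y, a x y = a y x) /\ (forall x y, ~~ nbr x y -> a x y = 0).

Definition uniformly_elliptic a :=
  exists2 c : R, 1 <= c & forall x y, nbr x y -> c^-1 <= a x y <= c.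

(* A finitely supported sum: [a x] vanishes off the four neighbours of [x]. *)
Definition vertex_weight a x : R := \sum_(y \in [set: Z2]) a x y.

Definition transition a x y : R := a x y / vertex_weight a x.

Definition graph_dist x y : \bar R :=
  ereal_inf [set (size s)%:R%:E | s in [set s | path nbr x s /\ last x s = y]].

Definition dist_set x A : \bar R := ereal_inf [set graph_dist x y | y in A].

(* The filter "D(x, A) --> +oo" on vertices x. *)
Definition away_from A : set_system Z2 :=
  filter_from [set: R] (fun M => [set x | (M%:E < dist_set x A)%E]).

End WeightedLattice.

Section RandomWalk.
Context {R : realType} {d : measure_display} {Omega : measurableType d}.
Implicit Types (P : Z2 -> probability Omega R) (X : nat -> Omega -> Z2).

(* [P x] is the law under which [X] is the Markov chain started at [x] with
   transition probabilities [transition a]. The Markov property is written in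
   product form, so that nothing is asked when conditioning on a null event. *)
Definition random_walk (a : Z2 -> Z2 -> R) P X :=
  [/\ forall k z, measurable [set w | X k w = z],
      forall x, P x [set w | X 0 w = x] = 1%E
    & forall x (z : nat -> Z2) n,
        P x [set w | forall i, (i <= n.+1)%N -> X i w = z i] =
        (P x [set w | forall i, (i <= n)%N -> X i w = z i] *
         (transition a (z n) (z n.+1))%:E)%E].

(* Equal to [+oo] when the set is never hit at a positive time. *)
Definition hitting_time X (A : set Z2) (w : Omega) : \bar R :=
  ereal_inf [set k%:R%:E | k in [set k : nat | (1 <= k)%N /\ A (X k w)]].

Definition hit X A : set Omega := [set w | (hitting_time X A w < +oo)%E].

Definition hit_at X A (y : Z2) : set Omega :=
  [set w | exists2 k : nat, hitting_time X A w = k%:R%:E & X k w = y].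

(* The conditional law of [X] at its hitting time of [A], given that this time
   is finite; the junk value is 0 when that event is null. *)
Definition harmonic_measure P X A (x y : Z2) : R :=
  fine (P x (hit_at X A y `&` hit X A)) / fine (P x (hit X A)).

End RandomWalk.

(* Main.v *)
(* The probability that the walk started at x hits the finite set A, and does so at y,
   is a function h of x with values in [0, 1] that is harmonic off A. For a finitely
   supported cutoff phi, summation by parts against phi^2 h bounds the energy of phi h
   by 4c plus c times the energy of phi, and in two dimensions logarithmic cutoffs make
   the latter arbitrarily small. So h has finite Dirichlet energy. For a bounded
   nonnegative function v with v times its Laplacian nonpositive, the same computation
   gives energy 0, hence v is constant: this yields the maximum principle outside a
   finite set, and P_x(tau_A < oo) = 1.
   By the length-area method some rings of arbitrarily large radius carry an arbitrarily
   small oscillation of h (the sum of 1/r diverges, the energy converges); by the maximum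
   principle the oscillation of h outside such a ring is equally small. *)

Require Import Defs.
From mathcomp Require Import all_boot all_order all_algebra.
From mathcomp Require Import all_classical all_reals all_analysis.
From mathcomp Require Import zify ring lra.

Set Implicit Arguments.
Unset Strict Implicit.
Unset Printing Implicit Defensive.

Import Order.TTheory GRing.Theory Num.Theory.
Import numFieldNormedType.Exports.
Local Open Scope classical_set_scope.
Local Open Scope ring_scope.

(* [znorm i <= r] is the interval [-r-1, r], symmetric about -1/2: then every value
   is taken exactly twice, and sums over boxes split into rings without a special case. *)
Definition znorm (i : int) : nat := match i with Posz k | Negz k => k end.

Definition boxnorm (x : Z2) : nat := maxn (znorm x.1) (znorm x.2).

Definition e1 : Z2 := (1, 0).
Definition e2 : Z2 := (0, 1).

Lemma nbr_e1 (x : Z2) : nbr x (x + e1).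
Proof. by case: x => i j; rewrite /nbr /=; lia. Qed.

Lemma nbr_e2 (x : Z2) : nbr x (x + e2).
Proof. by case: x => i j; rewrite /nbr /=; lia. Qed.

Lemma pair_e1 (i j : int) : ((i, j) : Z2) + e1 = (i + 1, j).
Proof. by congr pair; rewrite /= addr0. Qed.

Lemma pair_e2 (i j : int) : ((i, j) : Z2) + e2 = (i, j + 1).
Proof. by congr pair; rewrite /= addr0. Qed.

Lemma pair_Ne1 (i j : int) : ((i, j) : Z2) - e1 = (i - 1, j).
Proof. by congr pair; rewrite /= subr0. Qed.

Lemma pair_Ne2 (i j : int) : ((i, j) : Z2) - e2 = (i, j - 1).
Proof. by congr pair; rewrite /= subr0. Qed.

Lemma znorm_succ (i : int) :
  (znorm (i + 1)%R <= (znorm i).+1)%N /\ (znorm i <= (znorm (i + 1)%R).+1)%N.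
Proof. by case: i => [k|[|k]] /=; split; lia. Qed.

Lemma boxnorm_e1 (x : Z2) :
  (boxnorm (x + e1)%R <= (boxnorm x).+1)%N /\ (boxnorm x <= (boxnorm (x + e1)%R).+1)%N.
Proof.
case: x => i j; rewrite /boxnorm /= addr0.
by have [] := znorm_succ i; lia.
Qed.

Lemma boxnorm_e2 (x : Z2) :
  (boxnorm (x + e2)%R <= (boxnorm x).+1)%N /\ (boxnorm x <= (boxnorm (x + e2)%R).+1)%N.
Proof.
case: x => i j; rewrite /boxnorm /= addr0.
by have [] := znorm_succ j; lia.
Qed.

(** * Sums over boxes *)

Section BoxSums.
Context {R : realType}.
Implicit Types (f g : int -> R) (F G : Z2 -> R) (n m : nat).

Definition zsum n f : R := \sum_(k < n) (f (Posz k) + f (Negz k)).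

Definition boxsum n F : R := zsum n (fun i => zsum n (fun j => F (i, j))).

Lemma zsumS n f : zsum n.+1 f = zsum n f + (f (Posz n) + f (Negz n)).
Proof. by rewrite /zsum big_ord_recr. Qed.

Lemma zsumD n f g : zsum n (fun i => f i + g i) = zsum n f + zsum n g.
Proof.
rewrite /zsum -big_split /=; apply: eq_bigr => k _.
by rewrite addrACA.
Qed.

Lemma zsumM n c f : zsum n (fun i => c * f i) = c * zsum n f.
Proof. by rewrite /zsum mulr_sumr; apply: eq_bigr => k _; rewrite mulrDr. Qed.

Lemma ler_zsum n f g : (forall i, (znorm i < n)%N -> f i <= g i) ->
  zsum n f <= zsum n g.
Proof. by move=> fg; apply: ler_sum => k _; apply: lerD; apply: fg => /=. Qed.

Lemma eq_zsum n f g : (forall i, (znorm i < n)%N -> f i = g i) ->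
  zsum n f = zsum n g.
Proof. by move=> fg; apply: eq_bigr => k _; congr (_ + _); apply: fg => /=. Qed.

Lemma zsum_ge0 n f : (forall i, 0 <= f i) -> 0 <= zsum n f.
Proof. by move=> f0; apply: sumr_ge0 => k _; apply: addr_ge0. Qed.

Lemma zsum_widen n m f : (n <= m)%N -> (forall i, 0 <= f i) ->
  zsum n f <= zsum m f.
Proof.
move=> nm f0; rewrite -(subnK nm); elim: (m - n)%N => [|k IH]; first by rewrite add0n.
by rewrite addSn zsumS (le_trans IH)// lerDl addr_ge0.
Qed.

Lemma zsum_telescope n f :
  zsum n (fun i => f (i + 1) - f i) = f (Posz n) - f (- Posz n).
Proof.
elim: n => [|n IH]; first by rewrite /zsum big_ord0 oppr0 subrr.
rewrite zsumS IH.
have -> : Posz n + 1 = n.+1 by lia.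
have -> : Negz n + 1 = - Posz n by lia.
have -> : - Posz n.+1 = Negz n by lia.
ring.
Qed.

Lemma zsum_exchange n m (h : int -> int -> R) :
  zsum n (fun i => zsum m (h i)) = zsum m (fun j => zsum n (h ^~ j)).
Proof.
rewrite /zsum; under eq_bigr do rewrite -big_split /=.
rewrite exchange_big /=; apply: eq_bigr => k _.
by rewrite -big_split /=; apply: eq_bigr => l _; rewrite addrACA.
Qed.

Lemma zsum_indic n (j : int) : zsum n (fun i => (i == j)%:R) = (znorm j < n)%N%:R.
Proof.
elim: n => [|n IH]; first by rewrite /zsum big_ord0.
rewrite zsumS IH -!natrD; congr _%:R.
case: j {IH} => k.
  have -> : (Posz n == Posz k) = (n == k) by [].
  have -> : (Negz n == Posz k) = false by [].
  by rewrite /= ltnS; case: (ltngtP k n) => //.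
have -> : (Negz n == Negz k) = (n == k) by [].
have -> : (Posz n == Negz k) = false by [].
by rewrite /= ltnS; case: (ltngtP k n) => //.
Qed.

Lemma boxsumD n F G : boxsum n (fun x => F x + G x) = boxsum n F + boxsum n G.
Proof. by rewrite /boxsum -zsumD; apply: eq_zsum => i _; rewrite zsumD. Qed.

Lemma boxsumM n c F : boxsum n (fun x => c * F x) = c * boxsum n F.
Proof. by rewrite /boxsum -zsumM; apply: eq_zsum => i _; rewrite zsumM. Qed.

Lemma boxsumB n F G : boxsum n (fun x => F x - G x) = boxsum n F - boxsum n G.
Proof.
rewrite -[X in _ - X]mul1r -mulNr -boxsumM -boxsumD.
by congr boxsum; apply/funext => x; rewrite mulN1r.
Qed.

Lemma ler_boxsum n F G : (forall x, (boxnorm x < n)%N -> F x <= G x) ->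
  boxsum n F <= boxsum n G.
Proof.
move=> FG; apply: ler_zsum => i ni; apply: ler_zsum => j nj; apply: FG.
by rewrite /boxnorm gtn_max /= ni.
Qed.

Lemma eq_boxsum n F G : (forall x, (boxnorm x < n)%N -> F x = G x) ->
  boxsum n F = boxsum n G.
Proof. by move=> FG; apply/eqP; rewrite eq_le !ler_boxsum// => x /FG ->. Qed.

Lemma boxsum_widen n m F : (n <= m)%N -> (forall x, 0 <= F x) ->
  boxsum n F <= boxsum m F.
Proof.
move=> nm F0; apply: (@le_trans _ _ (zsum n (fun i => zsum m (fun j => F (i, j))))).
  by apply: ler_zsum => i _; exact: zsum_widen.
by apply: zsum_widen => // i; exact: zsum_ge0.
Qed.

Lemma boxsum_indic n c (y : Z2) :
  boxsum n (fun x => c * (x == y)%:R) = c * (boxnorm y < n)%N%:R.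
Proof.
rewrite boxsumM; congr (_ * _); case: y => k l; rewrite /boxsum.
under [X in zsum n X]funext => i.
  under [X in zsum n X]funext => j do rewrite xpair_eqE -mulnb natrM.
  rewrite zsumM zsum_indic mulrC.
  over.
by rewrite zsumM zsum_indic -natrM mulnb /boxnorm gtn_max andbC.
Qed.

Lemma ler_term_boxsum n F x : (boxnorm x < n)%N -> (forall z, 0 <= F z) ->
  F x <= boxsum n F.
Proof.
move=> xn F0; apply: (@le_trans _ _ (boxsum n (fun z => F x * (z == x)%:R))).
  by rewrite boxsum_indic xn mulr1.
by apply: ler_boxsum => z _; have [->|] := eqVneq z x; rewrite ?mulr1 ?mulr0.
Qed.

(** Rows run from -n to n - 1, and the left end -n has [znorm] equal to n - 1, so F has to vanish
    already on ring n - 1. *)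
Lemma boxsum_telescope1 n F : (forall x, (n <= (boxnorm x).+1)%N -> F x = 0) ->
  boxsum n (fun x => F (x + e1) - F x) = 0.
Proof.
move=> F0; rewrite /boxsum zsum_exchange /=.
rewrite (eq_zsum (g := fun=> 0 * 0)) ?zsumM ?mul0r// => j _.
rewrite (eq_zsum (g := fun i => F (i + 1, j) - F (i, j))); last first.
  by move=> i _; rewrite pair_e1.
rewrite (zsum_telescope n (fun i => F (i, j))) !F0 ?subrr ?mul0r//;
  rewrite /boxnorm /=; first by case: n {F0} => //= n; lia.
by lia.
Qed.

Lemma boxsum_telescope2 n F : (forall x, (n <= (boxnorm x).+1)%N -> F x = 0) ->
  boxsum n (fun x => F (x + e2) - F x) = 0.
Proof.
move=> F0; rewrite /boxsum /=.
rewrite (eq_zsum (g := fun=> 0 * 0)) ?zsumM ?mul0r// => i _.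
rewrite (eq_zsum (g := fun j => F (i, j + 1) - F (i, j))); last first.
  by move=> j _; rewrite pair_e2.
rewrite (zsum_telescope n (fun j => F (i, j))) !F0 ?subrr ?mul0r//;
  rewrite /boxnorm /=; last by lia.
by case: n {F0} => //= n; lia.
Qed.

End BoxSums.

(** * Logarithmic cutoffs *)

Section Capacity.
Context {R : realType}.
Implicit Types (n m : nat).

Definition harm n : R := \sum_(k < n) k.+1%:R^-1.

Lemma harmS n : harm n.+1 = harm n + n.+1%:R^-1.
Proof. by rewrite /harm big_ord_recr. Qed.

Lemma harm_homo n m : (n <= m)%N -> harm n <= harm m.
Proof.
move=> nm; rewrite -(subnK nm); elim: (m - n)%N => [|k IH]; first by rewrite add0n.
by rewrite addSn harmS (le_trans IH)// lerDl.
Qed.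

Lemma harm_ge0 n : 0 <= harm n.
Proof. by apply: sumr_ge0. Qed.

Lemma harm_unbounded (M : R) : exists n, M < harm n.
Proof.
apply: contrapT => /forallNP nM; apply: (@dvg_harmonic R).
apply: nondecreasing_is_cvgn.
  by move=> n m nm; rewrite /series /= !big_mkord; exact: harm_homo.
exists M => _ [n _ <-]; rewrite /series /= big_mkord leNgt; apply/negP; exact: nM.
Qed.

(** The factor 2 is for n = m + 1: the difference is then 1/n, and 1/n <= 2/(n + 1). *)
Lemma harm_dist n m : (n <= m.+1)%N -> (m <= n.+1)%N ->
  `|harm n - harm m| <= 2 / n.+1%:R.
Proof.
have inv k : 0 < k.+1%:R^-1 :> R by rewrite invr_gt0.
move=> nm mn; have [->|] := eqVneq n m.
  by rewrite subrr normr0 mulr_ge0.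
move=> nem; have [E|E] : (n = m.+1 \/ m = n.+1) by lia.
  rewrite E harmS addrC addKr gtr0_norm// ler_pdivlMr// mulrC ler_pdivrMr//.
  by rewrite -natrM ler_nat; lia.
rewrite E harmS opprD addrA subrr add0r normrN gtr0_norm//.
by rewrite -[leLHS]mul1r; apply: ler_wpM2r; [exact: ltW|rewrite ler1n].
Qed.

Lemma zsum_znorm n (g : nat -> R) :
  zsum n (fun i => g (znorm i)) = 2 * \sum_(k < n) g k.
Proof. by rewrite /zsum mulr_sumr; apply: eq_bigr => k _ /=; ring. Qed.

(** Ring k has of order k points, each of weight of order 1/k^2. This is where dimension two
    enters. *)
Lemma boxsum_inv_sqr n :
  boxsum n (fun x => ((boxnorm x).+1%:R ^+ 2)^-1) <= 8 * harm n.
Proof.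
(* Instead of counting rings, the summand is bounded by w(k, l) + w(l, k), where w charges a point
   to its larger coordinate. A row of w then sums to at most 2/(k + 1). *)
pose w (k l : nat) : R := (l <= k)%N%:R * (k.+1%:R ^+ 2)^-1.
have w0 k l : 0 <= w k l by rewrite mulr_ge0 ?invr_ge0 ?sqr_ge0.
have row k : (k < n)%N -> zsum n (fun j => w k (znorm j)) <= 2 / k.+1%:R.
  move=> kn; rewrite zsum_znorm ler_wpM2l// /w -mulr_suml.
  have -> : \sum_(i < n) (i <= k)%N%:R = k.+1%:R :> R.
    rewrite -natr_sum; congr _%:R.
    rewrite -(big_mkord xpredT (fun i => nat_of_bool (i <= k)%N)) (big_cat_nat _ kn) //=.
    rewrite [X in (X + _)%N](eq_big_nat _ _ (F2 := fun=> 1%N)); last by move=> i /=; lia.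
    rewrite [X in (_ + X)%N]big1_seq ?addn0 ?sum_nat_const_nat; first lia.
    by move=> i /=; rewrite mem_index_iota; lia.
  by rewrite expr2 invfM mulrA mulfV ?mul1r// pnatr_eq0.
have tot : zsum n (fun i => zsum n (fun j => w (znorm i) (znorm j))) <= 4 * harm n.
  apply: (@le_trans _ _ (zsum n (fun i => 2 / (znorm i).+1%:R))).
    by apply: ler_zsum => i /row.
  rewrite (zsum_znorm n (fun k => 2 / k.+1%:R)) -mulr_sumr mulrA.
  by rewrite ler_wpM2r ?harm_ge0//; lra.
have -> : 8 * harm n = 4 * harm n + 4 * harm n by ring.
apply: le_trans (lerD tot tot).
rewrite [X in _ + X]zsum_exchange.
rewrite -(boxsumD n (fun x => w (znorm x.1) (znorm x.2))
  (fun x => w (znorm x.2) (znorm x.1))).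
apply: ler_boxsum => -[i j] _; rewrite /boxnorm /=.
case: (leqP (znorm i) (znorm j)) => ij; first by rewrite {2}/w ij mul1r lerDr.
by rewrite {1}/w (ltnW ij) mul1r lerDl.
Qed.


Lemma clip_lip (s t : R) :
  `|Num.max 0 (Num.min 1 s) - Num.max 0 (Num.min 1 t)| <= `|s - t|.
Proof.
wlog st : s t / s <= t.
  move=> W; case: (leP s t) => [|/ltW] st; first exact: W.
  by rewrite distrC [leRHS]distrC; exact: W.
rewrite distrC [leRHS]distrC (@ger0_norm _ (t - s)) ?subr_ge0//.
have [s1|s1] := leP 1 s; have [t1|t1] := leP 1 t;
  rewrite ?(max_r ler01) ?subrr ?normr0 ?subr_ge0//.
- by move: (le_trans s1 st); rewrite leNgt t1.
- have [s0|s0] := leP 0 s; rewrite ger0_norm; lra.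
- have [s0|s0] := leP 0 s; have [t0|t0] := leP 0 t; rewrite ger0_norm; lra.
Qed.

(** Between radii n and m, phi falls from 1 to 0 linearly in the harmonic number of the radius.
    Along an edge at radius r it changes by at most 2/((r + 1) T), where T = H_m - H_n, so its
    energy is of order H_m/T^2, which tends to 0 as m grows. *)
Lemma capacity_zero n (eps : R) : 0 < eps ->
  exists (m : nat) (phi : Z2 -> R),
  [/\ (n <= m)%N, forall x, 0 <= phi x <= 1,
      forall x, (boxnorm x <= n)%N -> phi x = 1,
      forall x, (m <= boxnorm x)%N -> phi x = 0 &
      boxsum m.+1 (fun x => (phi (x + e1) - phi x) ^+ 2 +
                            (phi (x + e2) - phi x) ^+ 2) <= eps].
Proof.
move=> eps0; set h := harm n.
have h0 : 0 <= h := harm_ge0 n.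
(* B makes the final bound 64 (h + 2)/T at most eps; the extra 1 in the choice of m gives T >= 1 as
   well. *)
pose B := 64 * (h + 2) / eps.
have B0 : 0 <= B by apply: divr_ge0; [apply: mulr_ge0 => //; lra | exact: ltW].
have [m Bm] := harm_unbounded (h + (1 + B)).
set T := harm m - h.
have T1 : 1 <= T by rewrite /T; lra.
have TB : B <= T by rewrite /T; lra.
have T0 : 0 < T by lra.
have nm : (n <= m)%N.
  by rewrite leqNgt; apply/negP => /ltnW/harm_homo; rewrite -/h; rewrite /T in T1; lra.
pose phi x := Num.max 0 (Num.min 1 ((harm m - harm (boxnorm x)) / T)).
have step x y : (boxnorm y <= (boxnorm x).+1)%N -> (boxnorm x <= (boxnorm y).+1)%N ->
    (phi y - phi x) ^+ 2 <= 4 / T ^+ 2 * ((boxnorm x).+1%:R ^+ 2)^-1.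
  move=> yx xy.
  have -> : 4 / T ^+ 2 * ((boxnorm x).+1%:R ^+ 2)^-1 = (2 / (boxnorm x).+1%:R / T) ^+ 2.
    have q0 : (boxnorm x).+1%:R != 0 :> R by rewrite pnatr_eq0.
    by move: (_.+1%:R) q0 => q q0; field; rewrite q0 (gt_eqF T0).
  rewrite -(real_normK (num_real (phi y - phi x))) lerXn2r ?nnegrE//.
    by apply: divr_ge0; [rewrite divr_ge0|exact: ltW].
  apply: (le_trans (clip_lip _ _)).
  have -> : (harm m - harm (boxnorm y)) / T - (harm m - harm (boxnorm x)) / T =
    (harm (boxnorm x) - harm (boxnorm y)) / T by ring.
  rewrite normrM.
  have T'0 : 0 < T^-1 by rewrite invr_gt0.
  rewrite (gtr0_norm T'0) ler_pM2r//.
  exact: harm_dist.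
exists m, phi; split=> //.
- by move=> x; rewrite /phi le_max lexx /= ge_max ler01 ge_min lexx.
- move=> x /harm_homo; rewrite -/h => hx; rewrite /phi min_l ?max_r//.
  by rewrite ler_pdivlMr// mul1r /T; lra.
- move=> x /harm_homo hx; rewrite /phi max_l// ge_min; apply/orP; right.
  by rewrite ler_pdivrMr// mul0r; lra.
apply: (@le_trans _ _ (boxsum m.+1 (fun x => 8 / T ^+ 2 * ((boxnorm x).+1%:R ^+ 2)^-1))).
  apply: ler_boxsum => x _.
  have [? ?] := boxnorm_e1 x; have [? ?] := boxnorm_e2 x.
  have -> : 8 / T ^+ 2 = 4 / T ^+ 2 + 4 / T ^+ 2 by field; rewrite (gt_eqF T0).
  by rewrite mulrDl; apply: lerD; apply: step.
(* [harm m.+1] is at most T + h + 1, hence at most T (h + 2), because T >= 1 and h >= 0. *)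
rewrite boxsumM; apply: (@le_trans _ _ (8 / T ^+ 2 * (8 * (T * (h + 2))))).
  apply: ler_wpM2l; first by rewrite divr_ge0 ?sqr_ge0.
  apply: (le_trans (boxsum_inv_sqr _)); rewrite ler_wpM2l// harmS.
  have : m.+1%:R^-1 <= 1 :> R by rewrite invf_le1// ler1n.
  have -> : harm m = T + h by rewrite /T; ring.
  have : 0 <= (T - 1) * h by rewrite mulr_ge0// subr_ge0.
  move: (m.+1%:R^-1) => q; rewrite mulrBl mul1r mulrDr => Th q1; lra.
have -> : 8 / T ^+ 2 * (8 * (T * (h + 2))) = (B * eps) / T.
  by rewrite /B; field; rewrite !gt_eqF.
by rewrite ler_pdivrMr// mulrC ler_wpM2l// ltW.
Qed.

End Capacity.

(** * Dirichlet energy and the maximum principle *)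

Section Energy.
Context {R : realType}.
Variables (a : Z2 -> Z2 -> R) (c : R).
Hypothesis asym : forall x y, a x y = a y x.
Hypothesis a_bound : forall x y, 0 <= a x y <= c.
Implicit Types (n m : nat) (f g v phi : Z2 -> R) (x y e : Z2).

(** Sign convention: this is the nonnegative operator, so [laplacian v x <= 0] means that v is
    subharmonic at x. *)
Definition laplacian v x : R :=
  (a x (x + e1) * (v x - v (x + e1)) + a x (x - e1) * (v x - v (x - e1))) +
  (a x (x + e2) * (v x - v (x + e2)) + a x (x - e2) * (v x - v (x - e2))).

(** Each edge is charged once, to its left or lower endpoint. *)
Definition energy_density v x : R :=
  a x (x + e1) * (v (x + e1) - v x) ^+ 2 + a x (x + e2) * (v (x + e2) - v x) ^+ 2.

Lemma energy_density_ge0 v x : 0 <= energy_density v x.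
Proof.
have a0 z : 0 <= a x z by case/andP: (a_bound x z).
by apply: addr_ge0; rewrite mulr_ge0 ?sqr_ge0.
Qed.

(* The cross terms of [grad (phi^2 v) . grad v] complete a square:
   [(phi'^2 v' - phi^2 v) (v' - v) = (phi' v' - phi v)^2 - v v' (phi' - phi)^2]. *)
Lemma summation_by_parts n v phi :
  (forall x, (n <= (boxnorm x).+1)%N -> phi x = 0) ->
  boxsum n (fun x => phi x ^+ 2 * (v x * laplacian v x)) =
  boxsum n (energy_density (fun x => phi x * v x)) -
  boxsum n (fun x => a x (x + e1) * (v x * v (x + e1)) * (phi (x + e1) - phi x) ^+ 2 +
                     a x (x + e2) * (v x * v (x + e2)) * (phi (x + e2) - phi x) ^+ 2).
Proof.
move=> phi0.
(* [F e x] is what the edge from x - e to x contributes to phi^2 v times the Laplacian at x. Moving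
   it to x - e gathers both contributions of the edge at one endpoint. *)
pose F e x := phi x ^+ 2 * v x * a (x - e) x * (v x - v (x - e)).
have F0 e x : (n <= (boxnorm x).+1)%N -> F e x = 0.
  by move=> /phi0; rewrite /F => ->; rewrite expr0n /= !mul0r.
have := boxsum_telescope1 (F0 e1); have := boxsum_telescope2 (F0 e2).
move=> T2 T1.
pose G := energy_density (fun x => phi x * v x).
pose C x := a x (x + e1) * (v x * v (x + e1)) * (phi (x + e1) - phi x) ^+ 2 +
            a x (x + e2) * (v x * v (x + e2)) * (phi (x + e2) - phi x) ^+ 2.
transitivity (boxsum n (fun x => G x - C x - (F e1 (x + e1) - F e1 x)
                                 - (F e2 (x + e2) - F e2 x))); last first.
  by rewrite boxsumB T2 subr0 boxsumB T1 subr0 boxsumB.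
apply: eq_boxsum => x _; rewrite /F !addrK [a (x - e1) x]asym [a (x - e2) x]asym.
by rewrite /G /C /energy_density /laplacian; ring.
Qed.

(** Test against phi^2 v for a cutoff phi equal to 1 on the box. The source term stays below K since
    phi^2 <= 1, and the error is at most c times the cutoff energy, hence arbitrarily small. *)
Lemma energy_bounded n v y (K : R) : 0 <= K ->
  (forall x, 0 <= v x <= 1) ->
  (forall x, v x * laplacian v x <= K * (x == y)%:R) ->
  boxsum n (energy_density v) <= K.
Proof.
move=> K0 v01 vL.
have c0 : 0 <= c by case/andP: (a_bound e1 e1) => /le_trans h /h.
apply/ler_addgt0Pr => eps eps0.
(* The denominator is c + 1 because only c >= 0 is known at this point. *)
have d0 : 0 < eps / (c + 1) by rewrite divr_gt0//; lra.
have [m [phi [nm phi01 phi1 phi0 phiE]]] := capacity_zero n d0.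
have phi0' x : (m.+1 <= (boxnorm x).+1)%N -> phi x = 0 by rewrite ltnS; exact: phi0.
have := summation_by_parts v phi0'.
set S := boxsum _ _; set S1 := boxsum _ _; set S2 := boxsum _ _ => SE.
have SK : S <= K.
  apply: (@le_trans _ _ (boxsum m.+1 (fun x => K * (x == y)%:R))); last first.
    by rewrite boxsum_indic ler_piMr// lern1 leq_b1.
  apply: ler_boxsum => x _.
  have [xy|xy] := eqVneq x y; have := vL x;
    rewrite ?xy ?eqxx ?(negPf xy) ?mulr1 ?mulr0 => h.
    case/andP: (phi01 y) => p0 p1.
    have p2 : phi y ^+ 2 <= 1 by rewrite expr_le1.
    have p3 := sqr_ge0 (phi y).
    have [l0|l0] := leP 0 (v y * laplacian v y).
      by apply: le_trans h; rewrite ler_piMl.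
    by apply: le_trans K0; rewrite mulr_ge0_le0// ltW.
  by rewrite mulr_ge0_le0 ?sqr_ge0.
have S2e : S2 <= eps.
  have v2 x z : a x z * (v x * v z) <= c.
    case/andP: (a_bound x z) => a0 ac.
    case/andP: (v01 x) => ? ?; case/andP: (v01 z) => ? ?.
    rewrite -[leRHS]mulr1; apply: ler_pM => //; first exact: mulr_ge0.
    exact: mulr_ile1.
  apply: (@le_trans _ _ (boxsum m.+1 (fun x => c * ((phi (x + e1) - phi x) ^+ 2 +
                            (phi (x + e2) - phi x) ^+ 2)))).
    by apply: ler_boxsum => x _; rewrite mulrDr lerD// ler_wpM2r ?sqr_ge0.
  rewrite boxsumM; apply: (le_trans (ler_wpM2l c0 phiE)).
  rewrite mulrCA ger_pMr// ler_pdivrMr; lra.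
(* The edges charged to the box end at radius at most n, where phi is still 1. *)
have S1n : boxsum n (energy_density v) <= S1.
  apply: (@le_trans _ _ (boxsum n (energy_density (fun x => phi x * v x)))); last first.
    by apply: boxsum_widen => [|x]; [exact: leqW|exact: energy_density_ge0].
  apply: ler_boxsum => x xn; have [? _] := boxnorm_e1 x; have [? _] := boxnorm_e2 x.
  by rewrite /energy_density !phi1 ?mul1r //; lia.
by move: SE SK S2e S1n; lra.
Qed.

Hypothesis c0 : 0 < c.
Hypothesis a_lower : forall x y, nbr x y -> c^-1 <= a x y.

Lemma energy_density_lower v x :
  (v (x + e1) - v x) ^+ 2 + (v (x + e2) - v x) ^+ 2 <= c * energy_density v x.
Proof.
have low e : nbr x (x + e) ->
    (v (x + e) - v x) ^+ 2 <= c * (a x (x + e) * (v (x + e) - v x) ^+ 2).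
  move=> /a_lower h; rewrite mulrA -[leLHS]mul1r ler_wpM2r ?sqr_ge0//.
  by rewrite -ler_pdivrMl// mulr1.
by rewrite mulrDr lerD// low ?nbr_e1 ?nbr_e2.
Qed.

Lemma int_shift_const (f : int -> R) : (forall i, f (i + 1) = f i) -> forall i, f i = f 0.
Proof.
move=> fS; elim=> [//|n IH|n IH]; rewrite -IH.
  by rewrite -[f (Posz n)]fS; congr f; lia.
by rewrite -[LHS]fS; congr f; lia.
Qed.

(** With K = 0 the energy vanishes, so v is constant. The condition on the product imposes nothing
    where v vanishes, which admits truncations at 0. *)
Lemma subharmonic_eq0 v x0 : (forall x, 0 <= v x <= 1) ->
  (forall x, v x * laplacian v x <= 0) -> v x0 = 0 -> forall x, v x = 0.
Proof.
move=> v01 vL v0.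
have E0 x : energy_density v x <= 0.
  apply: le_trans (ler_term_boxsum (ltnSn _) (energy_density_ge0 v)) _.
  by apply: (@energy_bounded _ v x 0) => // z; rewrite mul0r.
have D x : v (x + e1) = v x /\ v (x + e2) = v x.
  have := le_trans (energy_density_lower v x) (mulr_ge0_le0 (ltW c0) (E0 x)).
  have h1 := sqr_ge0 (v (x + e1) - v x); have h2 := sqr_ge0 (v (x + e2) - v x).
  move=> h; split; apply/eqP; rewrite -subr_eq0 -sqrf_eq0 eq_le;
    apply/andP; split=> //; lra.
have const i j : v (i, j) = v (0, 0).
  rewrite (@int_shift_const (fun i => v (i, j))); last first.
    by move=> k; rewrite -pair_e1; case: (D (k, j)).
  rewrite (@int_shift_const (fun j => v (0, j)))// => k.
  by rewrite -pair_e2; case: (D (0, k)).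
by case=> i j; rewrite const; case: x0 v0 => k l; rewrite const.
Qed.

(** The region is infinite, and boundedness of v replaces a condition at infinity. Let w be the
    positive part of v - M beyond ring r and 0 elsewhere. Where w > 0 it equals v - M, while w >= v
    - M at the neighbours, so the Laplacian of w is at most that of v, which is 0. *)
Lemma maximum_principle_out v r (M : R) : (forall x, 0 <= v x <= 1) ->
  (forall x, (r < boxnorm x)%N -> laplacian v x = 0) ->
  (forall x, boxnorm x = r -> v x <= M) ->
  forall x, (r <= boxnorm x)%N -> v x <= M.
Proof.
move=> v01 vL vM.
(* The ring r is nonempty, so M >= 0; this keeps w at most 1. *)
have M0 : 0 <= M.
  apply: (@le_trans _ _ (v (Posz r, Posz r))).
    by case/andP: (v01 (Posz r, Posz r)).
  by apply: vM; rewrite /boxnorm /= maxnn.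
pose w x := if (boxnorm x <= r)%N then 0 else Num.max 0 (v x - M).
have w01 x : 0 <= w x <= 1.
  rewrite /w; case: ifP => _; first by rewrite lexx ler01.
  by case/andP: (v01 x) => ? ?; rewrite le_max lexx /= ge_max ler01 /=; lra.
(* The ring r itself is included: a point just beyond it has neighbours on it. *)
have wv x : (r <= boxnorm x)%N -> v x - M <= w x.
  rewrite /w leq_eqVlt => /orP[/eqP rx|rx].
    by rewrite -rx leqnn subr_le0 vM.
  by rewrite leqNgt rx /= le_max lexx orbT.
suff w0 x : w x = 0 by move=> x /wv; rewrite w0 subr_le0.
apply: (@subharmonic_eq0 w (0, 0)) => // {}x.
have [->|wx] := eqVneq (w x) 0; first by rewrite mul0r.
have [rx wE] : (r < boxnorm x)%N /\ w x = v x - M.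
  move: wx; rewrite /w; case: ltnP => rx; last by rewrite eqxx.
  by case: (leP (v x - M) 0); rewrite ?eqxx.
apply: mulr_ge0_le0; first by case/andP: (w01 x).
rewrite -(vL x rx) /laplacian.
have step z : (boxnorm x <= (boxnorm z).+1)%N ->
    a x z * (w x - w z) <= a x z * (v x - v z).
  move=> xz; have /wv h : (r <= boxnorm z)%N by lia.
  by apply: ler_wpM2l; [case/andP: (a_bound x z)|rewrite wE; lra].
have [_ ?] := boxnorm_e1 x; have [_ ?] := boxnorm_e2 x.
have [+ _] := boxnorm_e1 (x - e1); have [+ _] := boxnorm_e2 (x - e2).
rewrite !subrK => ? ?.
by apply: lerD; apply: lerD; apply: step.
Qed.

Lemma laplacian_compl v x : laplacian (fun z => 1 - v z) x = - laplacian v x.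
Proof. by rewrite /laplacian; ring. Qed.

(** The lower bound is the maximum principle applied to 1 - v. *)
Lemma oscillation_out v r x0 (d : R) : (forall x, 0 <= v x <= 1) ->
  (forall x, (r < boxnorm x)%N -> laplacian v x = 0) ->
  (forall x, boxnorm x = r -> `|v x - v x0| <= d) ->
  forall x, (r <= boxnorm x)%N -> `|v x - v x0| <= d.
Proof.
move=> v01 vL vd x rx; rewrite ler_norml; apply/andP; split.
  suff : 1 - v x <= 1 - v x0 + d by lra.
  apply: (@maximum_principle_out (fun z => 1 - v z) r) rx => z.
  - by case/andP: (v01 z) => ? ?; lra.
  - by move=> /vL; rewrite laplacian_compl => ->; rewrite oppr0.
  - by move=> /vd; rewrite ler_norml; lra.
suff : v x <= v x0 + d by lra.
by apply: (maximum_principle_out _ _ _ rx) => // z /vd; rewrite ler_norml; lra.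
Qed.

End Energy.

(** * The length-area method *)

Section LengthArea.
Context {R : realType}.
Implicit Types (f : int -> R) (v : Z2 -> R).

Lemma dist0_le_zsum n f i : (znorm i < n)%N ->
  `|f i - f 0| <= zsum n (fun i => `|f (i + 1) - f i|).
Proof.
(* The range of [zsum k] covers the paths from 0 to k and from 0 to -k alike; a negative i is
   reached as -(k + 1). *)
have key k : `|f (Posz k) - f 0| <= zsum k (fun i => `|f (i + 1) - f i|) /\
             `|f (- Posz k) - f 0| <= zsum k (fun i => `|f (i + 1) - f i|).
  elim: k => [|k [IH1 IH2]]; first by rewrite oppr0 subrr normr0 /zsum big_ord0.
  rewrite zsumS.
  have -> : Posz k.+1 = Posz k + 1 by lia.
  have -> : - (Posz k + 1) = Negz k by lia.
  have -> : Negz k + 1 = - Posz k by lia.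
  have n1 := normr_ge0 (f (Posz k + 1) - f (Posz k)).
  have n2 := normr_ge0 (f (- Posz k) - f (Negz k)).
  split.
    by have := ler_distD (f (Posz k)) (f (Posz k + 1)) (f 0); lra.
  have := ler_distD (f (- Posz k)) (f (Negz k)) (f 0).
  by rewrite (distrC (f (Negz k)) (f (- Posz k))); lra.
case: i => k /= kn; [have [+ _] := key k | have [_ +] := key k.+1];
  move=> /le_trans; apply; apply: zsum_widen => //; exact: ltnW.
Qed.

(** This is Cauchy-Schwarz over the 2n steps from -n to n, whence the bound eps^2/2, carried out
    termwise in linearised form. *)
Lemma dist0_le_sqr n f (eps : R) : 0 < eps ->
  n%:R * zsum n (fun i => (f (i + 1) - f i) ^+ 2) <= eps ^+ 2 / 2 ->
  forall i, (znorm i < n)%N -> `|f i - f 0| <= eps.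
Proof.
move=> eps0 nS i ni; apply: (le_trans (dist0_le_zsum f ni)).
have n0 : 0 < n%:R :> R by rewrite ltr0n; lia.
(* AM-GM: [|t| <= eps / (4 n) + n t^2 / eps] *)
apply: (@le_trans _ _ (zsum n (fun i => (n%:R / eps) * (f (i + 1) - f i) ^+ 2 +
                                        eps / (4 * n%:R)))).
  apply: ler_zsum => k _; move: (f (k + 1) - f k) => t.
  rewrite -(real_normK (num_real t)); move: `|t| => s.
  rewrite -subr_ge0.
  have -> : n%:R / eps * s ^+ 2 + eps / (4 * n%:R) - s =
    (n%:R / eps) * (s - eps / (2 * n%:R)) ^+ 2.
    by field; rewrite !gt_eqF.
  by rewrite mulr_ge0 ?sqr_ge0// divr_ge0// ltW.
rewrite zsumD.
have -> : zsum n (fun=> eps / (4 * n%:R)) = eps / 2.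
  by rewrite /zsum sumr_const card_ord -mulr_natr; field; rewrite gt_eqF.
rewrite zsumM.
suff : n%:R / eps * zsum n (fun i => (f (i + 1) - f i) ^+ 2) <= eps / 2 by lra.
rewrite mulrAC ler_pdivrMr//; apply: (le_trans nS).
by rewrite expr2 -!mulrA [eps / _]mulrC.
Qed.

Definition grad_sqr v (x : Z2) : R :=
  (v (x + e1) - v x) ^+ 2 + (v (x + e2) - v x) ^+ 2.

Lemma grad_sqr_ge0 v x : 0 <= grad_sqr v x.
Proof. by rewrite addr_ge0 ?sqr_ge0. Qed.

(** An upper bound for the squared differences along the ring rather than their exact sum: radial
    differences are included and corners are counted twice. *)
Definition ring_energy v (r : nat) : R :=
  zsum r.+1 (fun i => grad_sqr v (i, Posz r) + grad_sqr v (i, Negz r)) +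
  zsum r.+1 (fun j => grad_sqr v (Posz r, j) + grad_sqr v (Negz r, j)).

(** Prolonging the horizontal sides of the rings to full rows fills the box once; prolonging the
    vertical sides to full columns fills it a second time. *)
Lemma sum_ring_energy v n :
  \sum_(r < n) ring_energy v r <=
  2 * boxsum n (grad_sqr v).
Proof.
have q0 := grad_sqr_ge0 v.
rewrite /ring_energy big_split /= mulrDl !mul1r; apply: lerD.
  rewrite /boxsum zsum_exchange {2}/zsum; apply: ler_sum => r _.
  by rewrite -zsumD; apply: zsum_widen => // i; rewrite addr_ge0.
rewrite /boxsum {2}/zsum; apply: ler_sum => r _.
by rewrite -zsumD; apply: zsum_widen => // i; rewrite addr_ge0.
Qed.

Lemma ring_energy_ge0 v r : 0 <= ring_energy v r.
Proof.
by apply: addr_ge0; apply: zsum_ge0 => i; apply: addr_ge0; exact: grad_sqr_ge0.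
Qed.

(** Otherwise G r > d/(r + 1) from r0 on, and the divergence of the harmonic series contradicts the
    bound K. *)
Lemma exists_small_term (G : nat -> R) (K d : R) (r0 : nat) : 0 < d ->
  (forall n, 0 <= G n) -> (forall n, \sum_(r < n) G r <= K) ->
  exists2 r, (r0 <= r)%N & r.+1%:R * G r <= d.
Proof.
move=> d0 G0 GK; apply: contrapT => none.
have big r : (r0 <= r)%N -> d * r.+1%:R^-1 <= G r.
  move=> r0r; rewrite ler_pdivrMr ?ltr0n// mulrC leNgt; apply/negP => /ltW h.
  by apply: none; exists r.
have low n : d * (harm n - harm r0) <= \sum_(r < n) G r.
  elim: n => [|n IH].
    by rewrite big_ord0; apply: mulr_ge0_le0; [exact: ltW|rewrite subr_le0 harm_homo].
  have [nr|rn] := ltnP n r0.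
    apply: (@le_trans _ _ 0); last exact: sumr_ge0.
    by apply: mulr_ge0_le0; [exact: ltW|rewrite subr_le0 harm_homo].
  rewrite big_ord_recr /= harmS addrAC mulrDr lerD//; exact: big.
have [n] := harm_unbounded (K / d + harm r0).
rewrite -ltrBrDr ltr_pdivrMr// => h; have := le_trans (low n) (GK n).
by rewrite leNgt mulrC h.
Qed.

(** On each side v stays within eps/4 of its value at coordinate 0, so it oscillates by at most
    eps/2. Every point of the ring is joined to the corner (r, r) along at most two sides. *)
Lemma ring_oscillation v r (eps : R) : 0 < eps ->
  r.+1%:R * ring_energy v r <= (eps / 4) ^+ 2 / 2 ->
  forall x, boxnorm x = r -> `|v x - v (Posz r, Posz r)| <= eps.
Proof.
move=> eps0 small.
have e40 : 0 < eps / 4 by rewrite divr_gt0.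
have side (f : int -> R) :
    zsum r.+1 (fun i => (f (i + 1) - f i) ^+ 2) <= ring_energy v r ->
    forall i j, (znorm i <= r)%N -> (znorm j <= r)%N -> `|f i - f j| <= eps / 2.
  move=> fE.
  have h : r.+1%:R * zsum r.+1 (fun i => (f (i + 1) - f i) ^+ 2) <= (eps / 4) ^+ 2 / 2.
    by apply: le_trans small; rewrite ler_wpM2l.
  move=> i j ir jr.
  have := dist0_le_sqr e40 h (i := i) ir; have := dist0_le_sqr e40 h (i := j) jr.
  by have := ler_distD (f 0) (f i) (f j); rewrite (distrC (f 0)); lra.
have q0 := grad_sqr_ge0 v.
have q1 (i j : int) : (v (i + 1, j) - v (i, j)) ^+ 2 <= grad_sqr v (i, j).
  by rewrite /grad_sqr pair_e1 lerDl sqr_ge0.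
have q2 (i j : int) : (v (i, j + 1) - v (i, j)) ^+ 2 <= grad_sqr v (i, j).
  by rewrite /grad_sqr pair_e2 lerDr sqr_ge0.
have row0 : 0 <= zsum r.+1 (fun i => grad_sqr v (i, Posz r) + grad_sqr v (i, Negz r)).
  by apply: zsum_ge0 => i; rewrite addr_ge0.
have col0 : 0 <= zsum r.+1 (fun j => grad_sqr v (Posz r, j) + grad_sqr v (Negz r, j)).
  by apply: zsum_ge0 => i; rewrite addr_ge0.
have top : forall i j, (znorm i <= r)%N -> (znorm j <= r)%N ->
    `|v (i, Posz r) - v (j, Posz r)| <= eps / 2.
  apply: (side (fun i => v (i, Posz r))); apply: ler_wpDr => //.
  by apply: ler_zsum => i _; apply: ler_wpDr.
have bot : forall i j, (znorm i <= r)%N -> (znorm j <= r)%N ->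
    `|v (i, Negz r) - v (j, Negz r)| <= eps / 2.
  apply: (side (fun i => v (i, Negz r))); apply: ler_wpDr => //.
  by apply: ler_zsum => i _; apply: ler_wpDl.
have rig : forall i j, (znorm i <= r)%N -> (znorm j <= r)%N ->
    `|v (Posz r, i) - v (Posz r, j)| <= eps / 2.
  apply: (side (fun i => v (Posz r, i))); apply: ler_wpDl => //.
  by apply: ler_zsum => i _; apply: ler_wpDr.
have lef : forall i j, (znorm i <= r)%N -> (znorm j <= r)%N ->
    `|v (Negz r, i) - v (Negz r, j)| <= eps / 2.
  apply: (side (fun i => v (Negz r, i))); apply: ler_wpDl => //.
  by apply: ler_zsum => i _; apply: ler_wpDl.
have rr : (znorm (Posz r) <= r)%N by [].
have nr : (znorm (Negz r) <= r)%N by [].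
case=> i j; rewrite /boxnorm /= => ij.
have [ir jr] : (znorm i <= r)%N /\ (znorm j <= r)%N by lia.
have : [\/ i = Posz r, i = Negz r, j = Posz r | j = Negz r].
  have [E|E] : znorm i = r \/ znorm j = r by lia.
    by case: i E {ir ij} => k /= ->; [constructor 1|constructor 2].
  by case: j E {jr ij} => k /= ->; [constructor 3|constructor 4].
case=> ->.
- by apply: le_trans (rig _ _ jr rr) _; lra.
- have := lef _ _ jr rr; have := top _ _ nr rr.
  by have := ler_distD (v (Negz r, Posz r)) (v (Negz r, j)) (v (Posz r, Posz r)); lra.
- by apply: le_trans (top _ _ ir rr) _; lra.
- have := bot _ _ ir rr; have := rig _ _ nr rr.
  by have := ler_distD (v (Posz r, Negz r)) (v (i, Negz r)) (v (Posz r, Posz r)); lra.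
Qed.
End LengthArea.

(** Diagonal points serve as references: beyond a good ring r, v stays within eps of v (r, r). So v
    is Cauchy along the diagonal, and its limit there is the limit in all directions. *)
Lemma bounded_harmonic_limit (R : realType) (a : Z2 -> Z2 -> R) (c K : R)
    (v : Z2 -> R) (y : Z2) (r0 : nat) :
  (forall x y, a x y = a y x) -> (forall x y, 0 <= a x y <= c) -> 0 < c ->
  (forall x y, nbr x y -> c^-1 <= a x y) -> 0 <= K ->
  (forall x, 0 <= v x <= 1) ->
  (forall x, v x * laplacian a v x <= K * (x == y)%:R) ->
  (forall x, (r0 < boxnorm x)%N -> laplacian a v x = 0) ->
  exists l, forall eps : R, 0 < eps ->
    exists r, forall x, (r <= boxnorm x)%N -> `|v x - l| <= eps.
Proof.
move=> asym ab c0 alow K0 v01 vK vL.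
have osc (eps : R) : 0 < eps -> exists r,
    forall x, (r <= boxnorm x)%N -> `|v x - v (Posz r, Posz r)| <= eps.
  move=> eps0.
  have d0 : 0 < (eps / 4) ^+ 2 / 2 by rewrite divr_gt0// exprn_gt0// divr_gt0.
  (* Ellipticity turns the bound K on the weighted energy into a bound on the unweighted ring
     energies, uniform in n. *)
  have GK n : \sum_(r < n) ring_energy v r <= 2 * (c * K).
    apply: (le_trans (sum_ring_energy v n)); rewrite ler_wpM2l//.
    apply: (@le_trans _ _ (boxsum n (fun x => c * energy_density a v x))).
      by apply: ler_boxsum => x _; exact: energy_density_lower.
    rewrite boxsumM ler_wpM2l ?(ltW c0)//.
    exact: (@energy_bounded _ _ _ asym ab n v y).
  have [r r0r small] := exists_small_term r0 d0 (ring_energy_ge0 v) GK.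
  exists r; apply: (oscillation_out asym ab c0 alow v01).
    by move=> x rx; apply: vL; exact: leq_ltn_trans rx.
  exact: ring_oscillation.
pose s (n : nat) := v (Posz n, Posz n).
have /cauchy_cvgP/cvg_ex[l sl] : cauchy (s @ \oo).
  apply: cauchy_exP => e e0.
  have e20 : 0 < e / 2 by rewrite divr_gt0.
  have [r rP] := osc _ e20.
  exists (s r); change (\forall n \near \oo, ball (s r) e (s n)).
  near=> n; rewrite /ball /= distrC.
  apply: (@le_lt_trans _ _ (e / 2)); last by lra.
  apply: rP; rewrite /boxnorm /= maxnn; near: n; exact: nbhs_infty_ge.
exists l => eps eps0.
have e30 : 0 < eps / 3 by rewrite divr_gt0.
have [r rP] := osc _ e30; exists r => x /rP xr.
have [N _ NP] := (cvgrPdist_le _ _).1 sl _ e30.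
have {}NP : `|s (maxn N r) - l| <= eps / 3 by rewrite distrC; apply: NP; exact: leq_maxl.
have {}rP : `|s (maxn N r) - v (Posz r, Posz r)| <= eps / 3.
  by apply: rP; rewrite /boxnorm /= maxnn leq_maxr.
have := ler_distD (v (Posz r, Posz r)) (v x) l.
have := ler_distD (s (maxn N r)) (v (Posz r, Posz r)) l.
rewrite (distrC (v (Posz r, Posz r)) (s _)).
by lra.
Unshelve. all: by end_near.
Qed.

(** * Hitting probabilities *)

Definition nbrs (x : Z2) : seq Z2 := [:: x + e1; x - e1; x + e2; x - e2].

Lemma nbr_in_nbrs x y : nbr x y = (y \in nbrs x).
Proof.
case: x => i j; case: y => k l; rewrite /nbr /nbrs /= !inE.
by rewrite !(pair_e1, pair_e2, pair_Ne1, pair_Ne2) !xpair_eqE; lia.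
Qed.

Lemma uniq_nbrs x : uniq (nbrs x).
Proof.
case: x => i j; rewrite /nbrs.
by rewrite !(pair_e1, pair_e2, pair_Ne1, pair_Ne2) /= !inE !xpair_eqE; lia.
Qed.

(** * The Laplacian and the transition probabilities *)

Section Lattice.
Context {R : realType}.
Variable a : Z2 -> Z2 -> R.
Hypothesis a_lattice : weighted_lattice a.

Lemma vertex_weightE x : vertex_weight a x = \sum_(z <- nbrs x) a x z.
Proof.
rewrite /vertex_weight (fsbigE (nbrs x)) ?uniq_nbrs//.
- by apply: eq_bigl => z; rewrite mem_set.
- by move=> z _ znx; case: a_lattice => _; apply; rewrite nbr_in_nbrs.
Qed.

Lemma laplacianE v x :
  laplacian a v x = vertex_weight a x * v x - \sum_(z <- nbrs x) a x z * v z.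
Proof. by rewrite vertex_weightE /nbrs /laplacian !big_cons !big_nil; ring. Qed.

Lemma laplacian_eq0 v x : vertex_weight a x != 0 ->
  v x = \sum_(z <- nbrs x) transition a x z * v z -> laplacian a v x = 0.
Proof.
move=> w0 vx; rewrite laplacianE vx mulr_sumr -sumrB big1// => z _.
by rewrite /transition; field.
Qed.

Lemma sum_transition x : vertex_weight a x != 0 ->
  \sum_(z <- nbrs x) transition a x z = 1.
Proof. by move=> w0; rewrite /transition -mulr_suml -vertex_weightE divff. Qed.

Variable c : R.
Hypothesis c1 : 1 <= c.
Hypothesis a_elliptic : forall x y, nbr x y -> c^-1 <= a x y <= c.

Lemma weight_bounds x y : 0 <= a x y <= c.
Proof.
have c0 : 0 < c by apply: lt_le_trans c1.
have [/a_elliptic/andP[h1 ->]|nxy] := boolP (nbr x y).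
  by rewrite andbT (le_trans _ h1)// invr_ge0 ltW.
by case: a_lattice => _ ->//; rewrite lexx ltW.
Qed.

Lemma vertex_weight_gt0 x : 0 < vertex_weight a x.
Proof.
have c0 : 0 < c by apply: lt_le_trans c1.
rewrite vertex_weightE big_cons ltr_pwDl//.
  apply: lt_le_trans (_ : c^-1 <= _); first by rewrite invr_gt0.
  by case/andP: (a_elliptic (nbr_e1 x)).
by apply: sumr_ge0 => z _; case/andP: (weight_bounds x z).
Qed.

Lemma vertex_weight_le x : vertex_weight a x <= 4 * c.
Proof.
rewrite vertex_weightE /nbrs !big_cons big_nil.
have h z : a x z <= c by case/andP: (weight_bounds x z).
have := h (x + e1); have := h (x - e1); have := h (x + e2); have := h (x - e2); lra.
Qed.

End Lattice.

(** * First entrances of the walk into a finite set *)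

Section HittingProbability.
Context {R : realType} {d : measure_display} {Omega : measurableType d}.
Variables (a : Z2 -> Z2 -> R) (P : Z2 -> probability Omega R) (X : nat -> Omega -> Z2).
Hypothesis a_lattice : weighted_lattice a.
Hypothesis weight_neq0 : forall x, vertex_weight a x != 0.
Hypothesis walk : random_walk a P X.
Implicit Types (x y s t : Z2) (E F : set Omega) (z : nat -> Z2) (n N : nat).

Let measX k s : measurable [set w | X k w = s].
Proof. by case: walk. Qed.

Lemma measurable_visit (B : set Z2) k : finite_set B -> measurable [set w | B (X k w)].
Proof.
move=> Bfin.
have -> : [set w | B (X k w)] = \bigcup_(s in B) [set w | X k w = s].
  apply/seteqP; split=> w /=; first by exists (X k w).
  by move=> [s Bs ->].
by apply: fin_bigcup_measurable => // s _; exact: measX.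
Qed.

Definition prob x E : R := fine (P x E).

Lemma prob_ge0 x E : 0 <= prob x E.
Proof. exact: fine_ge0. Qed.

Lemma prob_le1 x E : measurable E -> prob x E <= 1.
Proof.
by move=> mE; rewrite -[1]/(fine 1%E) fine_le ?fin_num_measure// probability_le1.
Qed.

Lemma probU x E F : measurable E -> measurable F -> [disjoint E & F] ->
  prob x (E `|` F) = prob x E + prob x F.
Proof.
move=> mE mF /disj_set2P EF.
by rewrite /prob measureU// fineD ?fin_num_measure.
Qed.

Lemma prob_mono x E F : measurable E -> measurable F -> E `<=` F -> prob x E <= prob x F.
Proof.
move=> mE mF EF; rewrite fine_le ?fin_num_measure//.
by apply: le_measure; rewrite ?inE.
Qed.

Lemma prob_split x E F : measurable E -> measurable F ->
  prob x E = prob x (E `&` F) + prob x (E `\` F).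
Proof.
move=> mE mF; rewrite -probU ?setUIDK//; [exact: measurableI|exact: measurableD|].
by apply/disj_set2P/seteqP; split=> w // [[_ ?] [_]].
Qed.

Lemma prob_full x E F : measurable E -> measurable F -> prob x F = 1 ->
  prob x (F `&` E) = prob x E.
Proof.
move=> mE mF F1; rewrite (prob_split x mE mF) setIC -[LHS]addr0; congr (_ + _).
apply/esym/eqP; rewrite eq_le prob_ge0 andbT.
have := prob_split x measurableT mF; rewrite setTI F1 {1}/prob probability_setT /= => h.
apply: (@le_trans _ _ (prob x (setT `\` F))); last by lra.
by apply: prob_mono; [exact: measurableD|exact: measurableD|move=> w []].
Qed.

Definition cylinder z n : set Omega := [set w | forall i, (i <= n)%N -> X i w = z i].

Lemma cylinderS z n : cylinder z n.+1 = cylinder z n `&` [set w | X n.+1 w = z n.+1].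
Proof.
apply/seteqP; split=> w /=.
  by move=> h; split=> [i ni|]; apply: h => //; exact: leqW.
by move=> [h1 h2] i; rewrite leq_eqVlt ltnS => /orP[/eqP ->//|/h1].
Qed.

Lemma measurable_cylinder z n : measurable (cylinder z n).
Proof.
elim: n => [|n IH]; last by rewrite cylinderS; exact: measurableI.
have -> : cylinder z 0 = [set w | X 0 w = z 0%N]; last exact: measX.
apply/seteqP; split=> w /=; first by apply.
by move=> h i; rewrite leqn0 => /eqP ->.
Qed.

(** A cylinder depends only on the values of z up to n, so the next value may be prescribed. This
    lets the product formula of [random_walk] speak of a step to any t. *)
Lemma cylinder_extend z n t : exists z',
  [/\ z' n = z n, z' n.+1 = t & cylinder z' n = cylinder z n].
Proof.
exists (fun i => if (i <= n)%N then z i else t); split; rewrite ?leqnn ?ltnn//.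
apply/seteqP; split=> w /= h i ni; first by rewrite h ni.
by rewrite h// ni.
Qed.

Lemma prob_cylinder_step x z n t :
  prob x (cylinder z n `&` [set w | X n.+1 w = t]) =
  prob x (cylinder z n) * transition a (z n) t.
Proof.
have [z' [zn zn1 <-]] := cylinder_extend z n t.
rewrite -zn1 -cylinderS -zn; case: walk => _ _ /(_ x z' n) h.
by rewrite /prob [P x _]h fineM ?fin_num_measure//; exact: measurable_cylinder.
Qed.

Lemma prob_decompose x E n (s : seq Z2) : measurable E -> uniq s ->
  prob x (E `&` [set w | X n w \in s]) =
  \sum_(t <- s) prob x (E `&` [set w | X n w = t]).
Proof.
move=> mE; elim: s => [_|t s IH /= /andP[ts us]].
  rewrite big_nil (_ : _ `&` _ = set0) /prob ?measure0//.
  by apply/seteqP; split=> w // [].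
rewrite big_cons -IH// -probU.
- congr prob; rewrite -setIUr; congr setI.
  apply/seteqP; split=> w /=; rewrite inE.
    by move=> /orP[/eqP|]; [left|right].
  by case=> [->|->]; rewrite ?eqxx ?orbT.
- exact: measurableI.
- apply: measurableI => //.
  apply: (@measurable_visit [set` s]); exact: finite_seq.
- apply/disj_set2P/seteqP; split=> w //= [[_ wt] [_ h]].
  by move: ts; rewrite -wt h.
Qed.

(** On the cylinder the transition probabilities to the four neighbours already add up to 1, so all
    other steps form a null event. *)
Lemma prob_one_step x z n E : measurable E -> E `<=` cylinder z n ->
  prob x E = \sum_(t <- nbrs (z n)) prob x (E `&` [set w | X n.+1 w = t]).
Proof.
move=> mE EF; set N := [set w | X n.+1 w \in nbrs (z n)].
have mN : measurable N.
  by apply: (@measurable_visit [set` nbrs (z n)]); exact: finite_seq.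
have mF := measurable_cylinder z n.
have := prob_split x mF mN; rewrite prob_decompose ?uniq_nbrs//.
under eq_bigr do rewrite prob_cylinder_step.
rewrite -mulr_sumr sum_transition// mulr1 => F0.
rewrite -prob_decompose ?uniq_nbrs// (prob_split x mE mN) -[RHS]addr0; congr (_ + _).
apply/eqP; rewrite eq_le prob_ge0 andbT.
apply: (@le_trans _ _ (prob x (cylinder z n `\` N))); last by lra.
apply: prob_mono; [exact: measurableD|exact: measurableD|].
by move=> w [/EF].
Qed.

Variables A Y : set Z2.
Hypothesis Afin : finite_set A.
Hypothesis YA : Y `<=` A.

(* The first visit to [A] after time [n] occurs by time [n + N], at a point of [Y]. *)
Fixpoint enters N n (w : Omega) : Prop :=
  if N is N'.+1 then Y (X n.+1 w) \/ (~ A (X n.+1 w) /\ enters N' n.+1 w) else False.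

Lemma measurable_enters N n : measurable (enters N n : set Omega).
Proof.
elim: N n => [n|N IH n]; first exact: measurable0.
apply: measurableU; first by apply: measurable_visit; exact: sub_finite_set Afin.
apply: measurableI; last exact: IH.
by apply: measurableC; exact: measurable_visit.
Qed.

Lemma enters_mono n :
  {homo (fun N => enters N n : set Omega) : N M / (N <= M)%N >-> N `<=` M}.
Proof.
move=> N M; elim: N M n => [|N IH] M n; first by move=> _ w [].
case: M => // M NM w /= [Yw|[Aw e]]; first by left.
by right; split=> //; exact: IH e.
Qed.

Lemma entersP w : (exists N, enters N 0 w) <->
  exists k, [/\ (0 < k)%N, Y (X k w) & forall i, (0 < i < k)%N -> ~ A (X i w)].
Proof.
split=> [[N]|[[|k] []// _ Yk nA]].
  suff gen n : enters N n w ->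
      exists k, [/\ (n < k)%N, Y (X k w) & forall i, (n < i < k)%N -> ~ A (X i w)].
    exact: gen.
  elim: N n => [n []|N IH n /= [Yw|[Aw /IH[k [nk Yk Ak]]]]].
    by exists n.+1; split=> // i; lia.
  exists k; split=> // [|i /andP[ni ik]]; first exact: ltnW.
  by have [->//|ni1] := eqVneq i n.+1; apply: Ak; lia.
exists k.+1.
suff gen m n : Y (X (n + m.+1) w) -> (forall i, (n < i < n + m.+1)%N -> ~ A (X i w)) ->
    enters m.+1 n w.
  by apply: gen => //; rewrite add0n.
elim: m n => [n|m IH n] /=; rewrite ?addn1 => Yw Aw; first by left.
right; split; first by apply: Aw; lia.
apply: IH; rewrite addSnnS//.
by move=> i h; apply: Aw; lia.
Qed.

(** Hitting times are positive, so the hitting probability from a point of A is not the boundary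
    value of the Dirichlet problem. On A it is replaced by the indicator of Y. *)
Definition with_boundary (f : Z2 -> R) t : R := if `[< A t >] then `[< Y t >]%:R else f t.

Fixpoint hit_prob N s : R :=
  if N is N'.+1 then
    \sum_(t <- nbrs s) transition a s t * with_boundary (hit_prob N') t
  else 0.

(** The Markov property, by induction on N for all cylinders at once. A step to t outside A prolongs
    the cylinder and leaves N - 1 steps; a step into A decides the event according to whether t is
    in Y. *)
Lemma prob_enters x z n N :
  prob x (cylinder z n `&` enters N n) = prob x (cylinder z n) * hit_prob N (z n).
Proof.
elim: N z n => [|N IH] z n.
  by rewrite /= mulr0 /prob setI0 measure0.
have mF := measurable_cylinder z n.
have mE : measurable (cylinder z n `&` enters N.+1 n).
  by apply: measurableI => //; exact: measurable_enters.
rewrite (prob_one_step x mE (@subIsetl _ _ _)).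
rewrite mulr_sumr; apply: eq_bigr => t _; rewrite mulrA -prob_cylinder_step.
rewrite /with_boundary; case: asboolP => At; last first.
  have [z' [zn zn1 zF]] := cylinder_extend z n t.
  rewrite -[in RHS]zF -zn1 -cylinderS -IH cylinderS zF zn1; congr prob.
  apply/seteqP; split=> w /=.
    by move=> [[Fw [Yw|[_ e]]] Xt]; [case: At; rewrite -Xt; exact: YA|].
  by move=> [[Fw Xt] e]; split=> //; split=> //; right; rewrite Xt.
case: asboolP => Yt; rewrite ?mulr1 ?mulr0.
  congr prob; apply/seteqP; split=> w /=; first by move=> [[]].
  by move=> [Fw Xt]; split=> //; split=> //; left; rewrite Xt.
rewrite (_ : _ `&` _ = set0) /prob ?measure0//.
by apply/seteqP; split=> w //= [[_ [Yw|[Aw _]]] Xt];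
  [apply: Yt|apply: Aw]; rewrite -Xt in At *.
Qed.

Lemma prob_enters0 x N : prob x (enters N 0) = hit_prob N x.
Proof.
have F1 : prob x (cylinder (fun=> x) 0) = 1.
  case: walk => _ /(_ x) h _; rewrite /prob (_ : cylinder _ _ = [set w | X 0 w = x]) ?h//.
  apply/seteqP; split=> w /=; first by apply.
  by move=> h' i; rewrite leqn0 => /eqP ->.
have mF := measurable_cylinder (fun=> x) 0; have mE := measurable_enters N 0.
have := prob_enters x (fun=> x) 0 N; rewrite F1 mul1r => <-.
by rewrite prob_full.
Qed.

Definition enters_ever : set Omega := [set w | exists N, enters N 0 w].

Lemma enters_everE : enters_ever = \bigcup_N (enters N 0 : set Omega).
Proof. by apply/seteqP; split=> w /= [N]; exists N. Qed.

Lemma measurable_enters_ever : measurable enters_ever.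
Proof.
by rewrite enters_everE; apply: bigcupT_measurable => N; exact: measurable_enters.
Qed.

(** Continuity of the measure from below, since the events [enters N 0] increase with N. *)
Lemma hit_prob_cvg s : hit_prob N s @[N --> \oo] --> prob s enters_ever.
Proof.
have -> : (fun N => hit_prob N s) = fine \o (fun N => P s (enters N 0)).
  by apply/funext => N /=; rewrite -prob_enters0.
apply: fine_cvg; rewrite fineK ?fin_num_measure//; last exact: measurable_enters_ever.
rewrite enters_everE; apply: nondecreasing_cvg_mu.
- by move=> N; exact: measurable_enters.
- by apply: bigcupT_measurable => N; exact: measurable_enters.
- by move=> N M NM; apply/subsetPset; exact: enters_mono.
Qed.

Definition hit_fun : Z2 -> R := with_boundary (fun s => prob s enters_ever).

Lemma hit_fun_ge0_le1 s : 0 <= hit_fun s <= 1.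
Proof.
rewrite /hit_fun /with_boundary; case: asboolP => _.
  by case: asboolP => _; rewrite ?lexx ?ler01.
by rewrite prob_ge0 prob_le1//; exact: measurable_enters_ever.
Qed.

(** The recursion defining [hit_prob] passes to the limit in N through a sum of four terms. *)
Lemma hit_fun_harmonic s : ~ A s -> laplacian a hit_fun s = 0.
Proof.
move=> nAs; apply: laplacian_eq0 => //; rewrite {1}/hit_fun /with_boundary.
case: asboolP => // _.
have h1 : hit_prob N.+1 s @[N --> \oo] --> prob s enters_ever.
  by have := @hit_prob_cvg s; rewrite -cvg_shiftS.
apply: (cvg_unique _ h1) => //=.
apply: cvg_big => // [|t _]; first exact: add_continuous.
apply: cvgMr; rewrite /hit_fun /with_boundary.
by case: asboolP => _; [exact: cvg_cst|exact: hit_prob_cvg].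
Qed.

End HittingProbability.

(** * Hitting times as first entrances *)

Section HittingTime.
Context {R : realType} {d : measure_display} {Omega : measurableType d}.
Variables (X : nat -> Omega -> Z2) (A : set Z2).

Lemma hitting_time_first (w : Omega) k : (0 < k)%N -> A (X k w) ->
  (forall i, (0 < i < k)%N -> ~ A (X i w)) ->
  hitting_time X A w = k%:R%:E :> \bar R.
Proof.
move=> k0 Ak nA; apply/eqP; rewrite eq_le; apply/andP; split.
  by apply: ereal_inf_lbound; exists k.
apply: le_ereal_inf_tmp => _ [i [i0 Ai] <-]; rewrite lee_fin ler_nat leqNgt.
by apply/negP => ik; apply: (nA i) => //; rewrite i0.
Qed.

Lemma hit_first (w : Omega) : (hitting_time X A w < +oo :> \bar R)%E ->
  exists k, [/\ (0 < k)%N, A (X k w) & forall i, (0 < i < k)%N -> ~ A (X i w)].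
Proof.
move=> h.
(* Without a visit at a positive time the infimum would be over the empty set, that is, +oo. *)
have ex : exists k, (0 < k)%N && `[< A (X k w) >].
  apply: contrapT => /forallNP none; move: h; rewrite /hitting_time.
  rewrite (_ : [set _ | _ in _] = set0) ?ereal_inf0 ?ltxx//.
  apply/seteqP; split=> _ //= [k [k0 Ak] _]; apply: (none k).
  by rewrite k0; apply/asboolP.
case: (ex_minnP ex) => k /andP[k0 /asboolP Ak] kmin; exists k.
split=> // i /andP[i0 ik] Ai.
by have := kmin i; rewrite i0 leqNgt ik => /(_ (asboolT Ai)).
Qed.

Lemma hitE : hit (R := R) X A = enters_ever X A A.
Proof.
apply/seteqP; split=> w; rewrite /enters_ever /= entersP; first exact: hit_first.
by move=> [k [k0 Ak nA]]; rewrite /hit /= (hitting_time_first k0 Ak nA) ltry.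
Qed.

Lemma hit_atE y : A y ->
  hit_at (R := R) X A y `&` hit (R := R) X A = enters_ever X A [set y].
Proof.
move=> Ay; apply/seteqP; split=> w; rewrite /enters_ever /= entersP.
  move=> [[k hk Xk] /hit_first[j [j0 Aj nA]]]; exists j; split=> //.
  move: hk; rewrite (hitting_time_first j0 Aj nA) => -[/eqP].
  by rewrite eqr_nat => /eqP ->.
move=> [k [k0 Xk nA]]; have Ak : A (X k w) by rewrite Xk.
have h := hitting_time_first k0 Ak nA.
by split; [exists k|rewrite /hit /= h ltry].
Qed.

End HittingTime.

(** The path corrects the first coordinate, then the second. It serves to bound the graph distance
    above by the l1 distance. *)
Lemma lattice_path (n : nat) (x y : Z2) : (absz (x.1 - y.1) + absz (x.2 - y.2))%N = n ->
  exists s : seq Z2, [/\ size s = n, path nbr x s & last x s = y].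
Proof.
case: y => k l; elim: n x => [|n IH] [i j] /=.
  by move=> h; exists [::]; split=> //=; congr pair; lia.
move=> h.
have [z [xz zn]] : exists z : Z2, nbr (i, j) z /\ (absz (z.1 - k) + absz (z.2 - l))%N = n.
  have [ik|ik|ik] := ltgtP i k.
  - by exists (i + 1, j); rewrite /nbr /=; lia.
  - by exists (i - 1, j); rewrite /nbr /=; lia.
  - have [jl|jl|jl] := ltgtP j l.
    + by exists (i, j + 1); rewrite /nbr /=; lia.
    + by exists (i, j - 1); rewrite /nbr /=; lia.
    + lia.
have [s [sn sp sl]] := IH z zn; exists (z :: s); split=> /=; last by [].
  by rewrite sn.
by rewrite xz.
Qed.

(** By contraposition: a point of [boxnorm] below r has both coordinates at most r in absolute
    value, hence lies within 2r + |y.1| + |y.2| of y, a point of A. *)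
Lemma away_from_boxnorm (R : realType) (A : set Z2) y (r : nat) : A y ->
  exists M : R, forall x, (M%:E < dist_set x A)%E -> (r <= boxnorm x)%N.
Proof.
move=> Ay; exists (r.*2 + absz y.1 + absz y.2)%N%:R => x; apply: contraTT.
rewrite -ltnNge -leNgt => xr.
apply: (@le_trans _ _ (graph_dist x y)).
  by apply: ereal_inf_lbound; exists y.
have [s [sn sp sl]] := @lattice_path _ x y erefl.
apply: (@le_trans _ _ (size s)%:R%:E).
  by apply: ereal_inf_lbound; exists s.
rewrite lee_fin ler_nat sn; case: x y xr {Ay sn sp sl s} => i j [k l] /=.
by rewrite /boxnorm /=; case: i => i; case: j => j /=; lia.
Qed.

Lemma finite_boxnorm_bounded (A : set Z2) : finite_set A ->
  exists r, forall x, A x -> (boxnorm x <= r)%N.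
Proof.
move=> /finite_seqP[s ->]; exists (\max_(x <- s) boxnorm x)%N => x /= xs.
exact: leq_bigmax_seq.
Qed.

(** * Recurrence and the limit at infinity *)

Section Limit.
Context {R : realType} {d : measure_display} {Omega : measurableType d}.
Variables (a : Z2 -> Z2 -> R) (P : Z2 -> probability Omega R) (X : nat -> Omega -> Z2).
Hypothesis a_lattice : weighted_lattice a.
Hypothesis a_elliptic : uniformly_elliptic a.
Hypothesis walk : random_walk a P X.
Variable A : set Z2.
Hypothesis Afin : finite_set A.

(** With Y = A, the function 1 - h vanishes on A and is harmonic off A, so [subharmonic_eq0]
    applies; the point y provides the zero. *)
Lemma hit_almost_surely y x : A y -> ~ A x -> prob P x (enters_ever X A A) = 1.
Proof.
move=> Ay nAx; case: a_elliptic => c c1 ell.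
have c0 : 0 < c by apply: lt_le_trans c1.
have w0 z : vertex_weight a z != 0.
  by rewrite gt_eqF// (vertex_weight_gt0 a_lattice c1 ell).
pose v z := 1 - hit_fun P X A A z.
suff : v x = 0.
  rewrite /v /hit_fun /with_boundary; case: asboolP => // _ /eqP.
  by rewrite subr_eq0 eq_sym => /eqP.
have vA z : A z -> v z = 0.
  by rewrite /v /hit_fun /with_boundary => Az; case: asboolP => // _; rewrite subrr.
apply: (@subharmonic_eq0 _ a c _ _ c0 _ v y) => [| | | z| z |].
- by case: a_lattice.
- exact: weight_bounds.
- by move=> ? ? /ell /andP[].
- by have := hit_fun_ge0_le1 walk Afin (@subset_refl _ A) z; rewrite /v; lra.
- have [Az|nAz] := pselect (A z); first by rewrite vA// mul0r.
  rewrite laplacian_compl.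
  by rewrite (hit_fun_harmonic a_lattice w0 walk Afin (@subset_refl _ A) nAz) oppr0 mulr0.
- exact: vA.
Qed.

(** The source is concentrated at y: h vanishes on the rest of A and is harmonic off A. At y, where
    h = 1, the Laplacian is at most the vertex weight, hence at most K = 4c. *)
Lemma hit_fun_limit y : A y -> exists l : R, forall eps, 0 < eps ->
  exists r, forall x, (r <= boxnorm x)%N -> `|hit_fun P X A [set y] x - l| <= eps.
Proof.
move=> Ay; case: a_elliptic => c c1 ell.
have c0 : 0 < c by apply: lt_le_trans c1.
have w0 z : vertex_weight a z != 0.
  by rewrite gt_eqF// (vertex_weight_gt0 a_lattice c1 ell).
have yA : [set y] `<=` A by move=> _ ->.
have v01 := hit_fun_ge0_le1 walk Afin yA.
have harm_off z := @hit_fun_harmonic _ _ _ _ _ _ a_lattice w0 walk _ _ Afin yA z.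
have [r0 r0P] := finite_boxnorm_bounded Afin.
apply: (@bounded_harmonic_limit _ a c (4 * c) _ y r0) => //.
- by case: a_lattice.
- exact: weight_bounds.
- by move=> ? ? /ell /andP[].
- by rewrite mulr_ge0// ltW.
- move=> z; have [Az|nAz] := pselect (A z); last first.
    by rewrite harm_off// mulr0 !mulr_ge0// ltW.
  have [->|zy] := eqVneq z y; last first.
    rewrite mulr0 {1}/hit_fun /with_boundary; case: asboolP => // _.
    by case: asboolP => [zy'|_]; [move/eqP: zy|rewrite mul0r].
  have -> : hit_fun P X A [set y] y = 1.
    by rewrite /hit_fun /with_boundary !asboolT.
  rewrite mul1r mulr1 (laplacianE a_lattice).
  have wy := vertex_weight_le a_lattice c1 ell y.
  have wy0 := vertex_weight_gt0 a_lattice c1 ell y.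
  have s0 : 0 <= \sum_(t <- nbrs y) a y t * hit_fun P X A [set y] t.
    apply: sumr_ge0 => t _; apply: mulr_ge0.
      by case/andP: (weight_bounds a_lattice c1 ell y t).
    by case/andP: (v01 t).
  case/andP: (v01 y) => v0 v1.
  have : vertex_weight a y * hit_fun P X A [set y] y <= vertex_weight a y.
    by rewrite ler_piMr// ltW.
  by lra.
- by move=> z rz; apply: harm_off => /r0P; rewrite leqNgt rz.
Qed.

End Limit.

Theorem theorem1p7 (R : realType) (a : Z2 -> Z2 -> R)
    (d : measure_display) (Omega : measurableType d)
    (P : Z2 -> probability Omega R) (X : nat -> Omega -> Z2) :
  weighted_lattice a -> uniformly_elliptic a -> random_walk a P X ->
  forall A : set Z2, finite_set A -> forall y : Z2, A y ->
  exists l : R, harmonic_measure P X A x y @[x --> away_from (R := R) A] --> l.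
Proof.
move=> a_lattice a_elliptic walk A Afin y Ay.
have [l lP] := hit_fun_limit a_lattice a_elliptic walk Afin Ay.
have [r0 r0P] := finite_boxnorm_bounded Afin.
exists l => B /nbhs_ballP[e /= e0 eB].
have e20 : 0 < e / 2 by rewrite divr_gt0.
have [r rP] := lP _ e20.
(* Radius r brings h close to its limit, and radius r0 + 1 puts x outside A. *)
have [M MP] := away_from_boxnorm R (maxn r r0.+1) Ay.
exists M => // x /= /MP; rewrite geq_max => /andP[rx r0x].
have nAx : ~ A x by move=> /r0P; rewrite leqNgt r0x.
apply: eB; rewrite /ball /= distrC.
(* Off A, h is the hitting probability itself, and the conditioning event has probability 1. *)
have -> : harmonic_measure P X A x y = hit_fun P X A [set y] x.
  rewrite /harmonic_measure hit_atE// hitE.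
  have := hit_almost_surely a_lattice a_elliptic walk Afin Ay nAx.
  rewrite /prob => ->; rewrite divr1 /hit_fun /with_boundary.
  by case: asboolP.
by apply: (le_lt_trans (rP _ rx)); lra.
Qed.
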